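(* Let $G$ be a finite nilpotent group. Then $\Gamma(G)$ is a cluster graph if and only if $G$ is (up to isomorphism) any one of the following groups: (a) a cyclic group of prime power order; (b) $C_p\times C_p$, where $p$ is a prime; (c) $Q_8$; (d) a non-cyclic $p$-group ($p$ a prime) such that all maximal subgroups of $G$ are cyclic; (e) $C_{pq}$, where $p,q$ are two distinct primes.
   Context: For a finite group $G$, the co-maximal subgroup graph $\Gamma(G)$ is the simple undirected graph whose vertices are the non-trivial proper subgroups of $G$, two distinct vertices $H,K$ being adjacent if and only if $HK=G$, where $HK=\{hk: h\in H, k\in K\}$. A graph is a cluster graph if it has no induced subgraph isomorphic to $P_3$, the path on $3$ vertices. $C_n$ denotes the cyclic group of order $n$. $Q_8$ is the group $Q_{2^n}=\langle r,s: r^{2^{n-1}}=1,\ r^{2^{n-2}}=s^2,\ srs^{-1}=r^{-1}\rangle$ with $n=3$. *)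

(* Defs.v *)
From mathcomp Require Import all_boot all_fingroup zmodp all_solvable.

Set Implicit Arguments.
Unset Strict Implicit.
Unset Printing Implicit Defensive.

Local Open Scope group_scope.

Record sgraph := SGraph {
  vertex :> finType;
  adj : rel vertex;
  adj_sym : symmetric adj;
  adj_irrefl : irreflexive adj
}.

Definition sgraph_iso (X Y : sgraph) : Prop :=
  exists2 f : X -> Y, bijective f & forall x y, adj (f x) (f y) = adj x y.

Section Induced.

Variables (X : sgraph) (S : {set X}).

Definition induced_adj : rel {x : X | x \in S} :=
  fun u v => adj (val u) (val v).

Fact induced_adj_sym : symmetric induced_adj.
Proof. by move=> u v; apply: adj_sym. Qed.

Fact induced_adj_irrefl : irreflexive induced_adj.
Proof. by move=> u; apply: adj_irrefl. Qed.

Definition induced : sgraph := SGraph induced_adj_sym induced_adj_irrefl.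

End Induced.

Section Path.

Variable n : nat.

Definition path_adj : rel 'I_n :=
  fun i j => (i.+1 == j :> nat) || (j.+1 == i :> nat).

Fact path_adj_sym : symmetric path_adj.
Proof. by move=> i j; rewrite /path_adj orbC. Qed.

Fact path_adj_irrefl : irreflexive path_adj.
Proof. by move=> i; rewrite /path_adj orbb; apply: gtn_eqF. Qed.

(* n is the number of vertices, not of edges. *)
Definition path_graph : sgraph := SGraph path_adj_sym path_adj_irrefl.

End Path.

Definition cluster_graph (X : sgraph) : Prop :=
  ~ exists S : {set X}, sgraph_iso (induced S) (path_graph 3).

Section Comaximal.

Variables (gT : finGroupType) (G : {group gT}).

Definition nontrivial_proper (H : {group gT}) : bool :=
  (H :!=: 1) && (H \proper G).

Definition comax_vertex := {H : {group gT} | nontrivial_proper H}.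

(* H * K is the product set, so this does not say that H and K generate G. *)
Definition comax_adj : rel comax_vertex :=
  fun H K => (H != K) && (val H * val K == G :> {set gT}).

Fact comax_adj_sym : symmetric comax_adj.
Proof.
suff sub (H K : comax_vertex) : comax_adj H K -> comax_adj K H.
  by move=> H K; apply/idP/idP; apply: sub.
case/andP=> neHK /eqP defG; rewrite /comax_adj eq_sym neHK /=.
have cHK : commute (val H : {set gT}) (val K).
  by apply/comm_group_setP; rewrite defG groupP.
by rewrite -cHK defG.
Qed.

Fact comax_adj_irrefl : irreflexive comax_adj.
Proof. by move=> H; rewrite /comax_adj eqxx. Qed.

Definition comax_graph : sgraph := SGraph comax_adj_sym comax_adj_irrefl.

End Comaximal.

(* Main.v *)
Require Import Defs.
From mathcomp Require Import all_boot all_fingroup zmodp all_solvable.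

(** For nilpotent [G], the graph is a cluster graph if and only if every factor
in a factorisation [G = H * K] into proper subgroups is maximal
([nil_comax_clusterP]).  If [H] lies strictly inside a proper subgroup [L], then
also [G = L * K] while [H * L = L], so [H - K - L] is an induced path.
Conversely, maximal subgroups of a nilpotent group are normal, so any two
distinct ones have product [G], and adjacency between factors is transitive.

If [G] is not a p-group, pick a prime [p] dividing [#|G|] and write [G] as the
direct product of its nontrivial p-part and p'-part.  Both are maximal, which
forces both to have prime order ([dprod_maximal_prime]), and [G] is cyclic of
order a product of two distinct primes.  Conversely, in a group of order [p * q]
a proper nontrivial subgroup has prime index, hence is maximal
([card_pq_cluster]).

If [G] is a noncyclic p-group and [M] is a maximal subgroup, take [x] in [M]
outside the Frattini subgroup.  Some maximal [N] misses [x], so [<[x]> * N = G]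
and the criterion makes [<[x]>] maximal, hence equal to [M]; thus [M] is cyclic
([cluster_maximal_cyclic]).  Conversely, let all maximal subgroups of a p-group
be cyclic and let [G = H * K] with [H], [K] contained in maximal subgroups [M],
[N], which are distinct since [H * K = G].  The subgroups of [M] form a chain and [M :&: N] has index [p] in [M], so a
proper subgroup [H] of [M] would lie in [N] together with [K]
([maximal_cyclic_cluster]).  The cyclic p-groups, [C_p x C_p] and [Q_8] all have
only cyclic maximal subgroups. *)

Set Implicit Arguments.
Unset Strict Implicit.
Unset Printing Implicit Defensive.

Local Open Scope group_scope.

(** * Cluster graphs *)

(** Having no induced path on three vertices means that adjacency is transitive
on distinct vertices. *)
Lemma cluster_graphP (X : sgraph) :
  cluster_graph X <->
  (forall x y z : X, adj x y -> adj y z -> x != z -> adj x z).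
Proof.
split=> [noP3 x y z Axy Ayz xz | trX [S [f [g fK gK] fA]]]; last first.
  pose i k : 'I_3 := inord k; pose v k : X := val (g (i k)).
  have gA a b : adj (v a) (v b) = path_adj (i a) (i b).
    by rewrite -[LHS]/(@adj (induced S) (g (i a)) (g (i b))) -fA !gK.
  suff: adj (v 0) (v 2) by rewrite gA /path_adj !inordK.
  apply: (trX (v 0) (v 1%N) (v 2)); rewrite ?gA /path_adj ?inordK //.
  by rewrite (inj_eq val_inj) (can_eq gK) -(inj_eq val_inj) /= !inordK.
have [//|nAxz] := boolP (adj x z); case: noP3.
have nexy: x != y by apply: contraTneq Axy => ->; rewrite adj_irrefl.
have neyz: y != z by apply: contraTneq Ayz => ->; rewrite adj_irrefl.
pose t := [tuple x; y; z]; have Ut: uniq t.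
  by rewrite /= !inE negb_or nexy xz neyz.
pose S : {set X} := [set u in t].
have St (i : 'I_3) : tnth t i \in S by rewrite inE mem_tnth.
pose g (i : 'I_3) : {u : X | u \in S} := exist _ (tnth t i) (St i).
have injg: injective g.
  move=> i j /(congr1 val)/= /eqP; rewrite !(tnth_nth x).
  by rewrite nth_uniq // => /eqP/val_inj.
have cardS: #|{: {u : X | u \in S}}| = 3.
  by rewrite card_sig cardsE (card_uniqP Ut).
have [f gK fK] : bijective g by apply: inj_card_bij; rewrite // cardS card_ord.
exists S, f; first by exists g.
have Ayx: adj y x by rewrite adj_sym.
have Azy: adj z y by rewrite adj_sym.
have nAzx: ~~ adj z x by rewrite adj_sym.
have gA i j : adj (tnth t i) (tnth t j) = path_adj i j.
  case: i j => [[|[|[|//]]] ?] [[|[|[|//]]] ?];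
    rewrite !(tnth_nth x) /path_adj /= ?adj_irrefl //; exact: negbTE.
by move=> u v; rewrite -{2}[u]fK -{2}[v]fK -[RHS]/(adj (tnth t (f u)) _) gA.
Qed.

(** * Factorisations of a nilpotent group into proper subgroups *)

Lemma nilpotent_maximal_normal (gT : finGroupType) (G M : {group gT}) :
  nilpotent G -> maximal M G -> M <| G.
Proof.
move=> nilG /maxgroupP[prM maxM]; have sMG := proper_sub prM.
rewrite /normal sMG; have:= subsetIl G 'N(M); rewrite subEproper.
case/predU1P=> [/setIidPl // | prN].
have sNM: 'N_G(M) \subset M by rewrite (maxM _ prN) // subsetI sMG normG.
by case/andP: prM => _ /negP[]; rewrite {1}(nilpotent_sub_norm nilG sMG sNM).
Qed.

Section Comaximal.

Variables (gT : finGroupType) (G : {group gT}).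
Implicit Types H K M : {group gT}.

Lemma maximal_if_only_over H :
    H \proper G ->
    (forall M, maximal M G -> H \subset M -> H :=: M) ->
  maximal H G.
Proof.
move=> prH sHmax; case: (maximal_exists (proper_sub prH)) => [eqHG|[M maxM sHM]].
  by move: prH; rewrite eqHG properxx.
by have -> : H = M by apply/group_inj/sHmax.
Qed.

Lemma comax_factor_nt H K :
  H \proper G -> H * K = G -> nontrivial_proper G K = (K \proper G).
Proof.
move=> prH defG; rewrite /nontrivial_proper andb_idl // => prK.
by apply: contraTneq prH => K1; rewrite -defG K1 mulg1 properxx.
Qed.

Lemma factorisation_sym H K : H * K = G -> K * H = G.
Proof.
move=> defG; have cHK: commute (H : {set gT}) K.
  by apply/comm_group_setP; rewrite defG groupP.
by rewrite -cHK.
Qed.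

(** In a factorisation into proper subgroups both factors are nontrivial, so the
criterion need not require them to be vertices. *)
Lemma nil_comax_clusterP :
  nilpotent G ->
  cluster_graph (comax_graph G) <->
  (forall H K, H \proper G -> K \proper G -> H * K = G -> maximal H G).
Proof.
move=> nilG; split=> [/cluster_graphP trG H K prH prK defG | maxG].
  have vK: nontrivial_proper G K by rewrite (comax_factor_nt prH).
  have vH: nontrivial_proper G H.
    by rewrite (comax_factor_nt prK) ?prH // factorisation_sym.
  apply: maximal_if_only_over => // L maxL sHL; have prL := maxgroupp maxL.
  have defG': L * K = G.
    apply/eqP; rewrite eqEsubset mul_subG ?(proper_sub prL) ?(proper_sub prK) //.
    by rewrite -{1}defG mulSg.
  have vL: nontrivial_proper G L.
    by rewrite (comax_factor_nt prK) ?prL // factorisation_sym.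
  pose u : comax_vertex G := exist _ H vH.
  pose v : comax_vertex G := exist _ K vK.
  pose w : comax_vertex G := exist _ L vL.
  have [[->] // | neuw] := eqVneq u w.
  have neq_adj (A B : comax_vertex G) :
    val A * val B = G :> {set gT} -> comax_adj A B.
    move=> defAB; rewrite /comax_adj defAB eqxx andbT.
    apply: contraTneq (valP A) => eqAB; move: defAB; rewrite -eqAB mulGid => eqAG.
    by rewrite /nontrivial_proper eqAG properxx andbF.
  have/andP[_ /eqP/= HL] :=
    trG u v w (neq_adj u v defG) (neq_adj v w (factorisation_sym defG')) neuw.
  by move: prL; rewrite -HL mulSGid // properxx.
apply/cluster_graphP=> -[H vH] [K vK] [L vL] /andP[_ /eqP/= HK].
move=> /andP[_ /eqP/= KL] neHL; apply/andP; split=> //=; apply/eqP.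
have [[_ prH] [_ prK] [_ prL]] := And3 (andP vH) (andP vK) (andP vL).
have maxH := maxG _ _ prH prK HK.
have maxL := maxG _ _ prL prK (factorisation_sym KL).
apply: mulg_normal_maximal (proper_sub prL) _ => //.
  exact: nilpotent_maximal_normal.
apply: contra neHL => sLH; apply/eqP/val_inj/group_inj=> /=.
by case/maxgroupP: maxL => _ /(_ H prH sLH).
Qed.

(** * Nilpotent groups whose graph is a cluster graph *)

(** A maximal direct factor leaves no room for a proper nontrivial subgroup in
the other factor. *)
Lemma dprod_maximal_prime H K :
  H \x K = G -> maximal H G -> prime #|K|.
Proof.
move=> defG maxH; have [nsHG _] := dprod_normal2 defG.
have [_ defHK _ tiHK] := dprodP defG; have prH := maxgroupp maxH.
have ntK: #|K| > 1.
  rewrite cardG_gt1; apply: contraTneq prH => K1.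
  by rewrite -defHK K1 mulg1 properxx.
have [x Kx ox] := Cauchy (pdiv_prime ntK) (pdiv_dvd #|K|).
have sxK: <[x]> \subset K by rewrite cycle_subG.
have tiHx: H :&: <[x]> = 1 by apply/trivgP; rewrite -tiHK setIS.
have ntx: <[x]> != 1.
  by rewrite -cardG_gt1 -orderE ox prime_gt1 ?pdiv_prime.
have defHx: H * <[x]> = G.
  apply: mulg_normal_maximal => //.
    by rewrite (subset_trans sxK) // -defHK mulG_subr.
  by apply: contraNN ntx => sxH; rewrite -tiHx (setIidPr sxH).
suff ->: #|K| = #[x] by rewrite ox pdiv_prime.
apply/eqP; rewrite -(eqn_pmul2l (cardG_gt0 H)) -TI_cardMg // defHK.
by rewrite orderE -TI_cardMg // defHx.
Qed.

Lemma cluster_not_pgroup :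
    nilpotent G -> cluster_graph (comax_graph G) ->
    (forall p, prime p -> ~~ p.-group G) ->
  exists p q : nat, [/\ prime p, prime q, p != q & G \isog Zp (p * q)%N].
Proof.
move=> nilG /(nil_comax_clusterP nilG) maxG notpG.
have ntG: #|G| > 1.
  rewrite cardG_gt1; apply: contra (notpG 2 isT) => /eqP->; exact: pgroup1.
pose p := pdiv #|G|; have prp: prime p := pdiv_prime ntG.
have defG := nilpotent_pcoreC p nilG; have [_ defPQ _ tiPQ] := dprodP defG.
have pP: p.-group 'O_p(G) := pcore_pgroup p G.
have p'Q: p^'.-group 'O_p^'(G) := pcore_pgroup p^' G.
have prP: 'O_p(G) \proper G.
  rewrite properEneq pcore_sub andbT.
  by apply: contraNneq (notpG p prp) => <-.
have prQ: 'O_p^'(G) \proper G.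
  rewrite properEneq pcore_sub andbT; apply: contraL (pdiv_dvd #|G|) => /eqP eqQG.
  by move: p'Q; rewrite eqQG /pgroup p'natE.
have prcQ: prime #|'O_p^'(G)|.
  by apply: dprod_maximal_prime defG _; apply: maxG defPQ.
have prcP: prime #|'O_p(G)|.
  have defG': 'O_p^'(G) \x 'O_p(G) = G by rewrite dprodC.
  by apply: dprod_maximal_prime defG' _; apply: maxG (factorisation_sym defPQ).
have coPQ: coprime #|'O_p(G)| #|'O_p^'(G)| := pnat_coprime pP p'Q.
exists #|'O_p(G)|, #|'O_p^'(G)|; split=> //.
  by apply: contraTneq coPQ => <-; rewrite /coprime gcdnn gtn_eqF ?prime_gt1.
have cycG: cyclic G by rewrite (cyclic_dprod defG) ?prime_cyclic.
rewrite isog_cyclic_card // -TI_cardMg // defPQ card_Zp ?cardG_gt0 // eqxx andbT.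
by rewrite /= /Zp; case: ifP => _; rewrite ?Zp_cycle ?cycle_cyclic ?cyclic1.
Qed.

Lemma cluster_maximal_cyclic (p : nat) M :
    p.-group G -> ~~ cyclic G -> cluster_graph (comax_graph G) ->
  maximal M G -> cyclic M.
Proof.
move=> pG ncycG /(nil_comax_clusterP (pgroup_nil pG)) maxG maxM.
have prM := maxgroupp maxM.
(* Otherwise any element of G outside M would generate G. *)
have nsMF: ~~ (M \subset 'Phi(G)).
  apply: contra ncycG => sMF; have [_ [x Gx notMx]] := properP prM.
  have sxG: <[x]> \subset G by rewrite cycle_subG.
  have [<- | [N maxN sxN]] := maximal_exists sxG; first exact: cycle_cyclic.
  have sMN := subset_trans sMF (Phi_sub_max maxN).
  case/negP: notMx; case/maxgroupP: maxM => _ /(_ N (maxgroupp maxN) sMN) <-.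
  by rewrite -cycle_subG.
have [x Mx notFx] := subsetPn nsMF.
have sxM: <[x]> \subset M by rewrite cycle_subG.
have prx: <[x]> \proper G := sub_proper_trans sxM prM.
have [N maxN notNx]: exists2 N : {group gT}, maximal N G & x \notin N.
  apply/exists_inP; apply: contraNT notFx; rewrite negb_exists_in.
  move/forall_inP=> allN; apply/bigcapP=> N /predU1P[-> | maxN].
    by rewrite (subsetP (proper_sub prM)).
  by rewrite -[_ \in _]negbK allN.
have defG: <[x]> * N = G.
  apply: factorisation_sym; apply: mulg_normal_maximal (proper_sub prx) _ => //.
    exact: p_maximal_normal pG maxN.
  by rewrite cycle_subG.
have /maxgroupP[_ maxx] := maxG _ _ prx (maxgroupp maxN) defG.
by rewrite (maxx M prM sxM) cycle_cyclic.
Qed.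

(** * Groups with a cluster co-maximal subgroup graph *)

Lemma maximal_cyclic_cluster (p : nat) :
    p.-group G -> (forall M, maximal M G -> cyclic M) ->
  cluster_graph (comax_graph G).
Proof.
move=> pG cycM; apply/(nil_comax_clusterP (pgroup_nil pG)) => H K prH prK defG.
apply: maximal_if_only_over => // M maxM sHM; have prM := maxgroupp maxM.
have [eqKG | [N maxN sKN]] := maximal_exists (proper_sub prK).
  by move: prK; rewrite eqKG properxx.
have prN := maxgroupp maxN; have pM := pgroupS (proper_sub prM) pG.
apply/eqP; apply: contraTT (prN) => neHM.
have prHM: H \proper M by rewrite properEneq neHM.
suff sHN: H \subset N.
  have/subset_trans/(_ (mul_subG sHN sKN)) : G \subset H * K by rewrite defG.
  by move=> sGN; rewrite properE sGN // andbF.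
have [sMN | nsMN] := boolP (M \subset N); first exact: subset_trans sMN.
have defNM: N * M = G.
  apply: mulg_normal_maximal (proper_sub prM) nsMN => //.
  exact: p_maximal_normal pG maxN.
have oM: (#|N :&: M| * p)%N = #|M|.
  apply/eqP; rewrite -(eqn_pmul2l (cardG_gt0 N)) mul_cardG defNM.
  rewrite mulnCA -(p_maximal_index pG maxN) Lagrange ?proper_sub //.
  by rewrite mulnC.
have [eqHM | [L maxL sHL]] := maximal_exists (proper_sub prHM).
  by move: prHM; rewrite eqHM properxx.
have sLM := proper_sub (maxgroupp maxL).
have oL: (#|L| * p)%N = #|M| by rewrite -(p_maximal_index pM maxL) Lagrange.
(* L and N :&: M have the same order, and M is cyclic. *)
have eqL: L :=: N :&: M.
  apply/eqP; rewrite (eq_subG_cyclic (cycM M maxM)) ?subsetIr //.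
  have p_gt0: p > 0 by rewrite -(p_maximal_index pG maxN).
  by rewrite -(eqn_pmul2r p_gt0) oL oM.
by rewrite (subset_trans sHL) // eqL subsetIl.
Qed.

Lemma cyclic_cluster (p : nat) :
  p.-group G -> cyclic G -> cluster_graph (comax_graph G).
Proof.
move=> pG cycG; apply: maximal_cyclic_cluster pG _ => M maxM.
exact: cyclicS (proper_sub (maxgroupp maxM)) cycG.
Qed.

Lemma card_psquare_cluster p :
  prime p -> #|G| = (p ^ 2)%N -> cluster_graph (comax_graph G).
Proof.
move=> prp oG; have pG: p.-group G by rewrite /pgroup oG pnatX pnat_id.
apply: maximal_cyclic_cluster (pG) _ => M maxM; apply: prime_cyclic.
suff -> : #|M| = p by [].
apply/eqP; rewrite -(eqn_pmul2r (prime_gt0 prp)) -{1}(p_maximal_index pG maxM).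
by rewrite Lagrange ?proper_sub ?(maxgroupp maxM) // oG mulnn.
Qed.

Lemma card_pq_cluster p q :
    nilpotent G -> prime p -> prime q -> #|G| = (p * q)%N ->
  cluster_graph (comax_graph G).
Proof.
move=> nilG prp prq oG; apply/(nil_comax_clusterP nilG) => H K prH prK defG.
have sHG := proper_sub prH; apply: p_index_maximal => //.
have iH1: #|G : H| != 1%N.
  by apply: contraTneq prH => /eqP; rewrite indexg_eq1 properE => ->; rewrite andbF.
have oH1: #|H| != 1%N.
  by apply: contraTneq prK => /card1_trivg H1; rewrite -defG H1 mul1g properxx.
have oHi: (#|H| * #|G : H|)%N = (p * q)%N by rewrite Lagrange.
have: p %| #|H| * #|G : H| by rewrite oHi dvdn_mulr.
rewrite Euclid_dvdM // => /orP[/dvdnP[a oH] | /dvdnP[b iH]].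
  suff /(prime_nt_dvdP prq iH1)-> : #|G : H| %| q by [].
  apply/dvdnP; exists a; apply/eqP; rewrite -(eqn_pmul2l (prime_gt0 prp)).
  by rewrite -oHi oH mulnA (mulnC p).
have eqq: (#|H| * b)%N = q.
  apply/eqP; rewrite -(eqn_pmul2r (prime_gt0 prp)) -mulnA -iH oHi mulnC //.
have oH: #|H| = q by apply/(prime_nt_dvdP prq oH1); rewrite -eqq dvdn_mulr.
suff -> : #|G : H| = p by [].
by apply/eqP; rewrite -(eqn_pmul2l (prime_gt0 prq)) -{1}oH oHi mulnC.
Qed.

(** Outside the cyclic subgroup of index two all elements of the quaternion
group have order four, which is the order of any maximal subgroup. *)
Lemma quaternion8_maximal_cyclic M :
  G \isog 'Q_8 -> maximal M G -> cyclic M.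
Proof.
move=> isoG maxM; have prM := maxgroupp maxM.
have [[x y] genG _] := generators_quaternion (isT : 2 < 3) isoG.
have [pG maxX _ _ _] := extremal_generators_facts (isT : prime 2) genG.
have [[_ o4 _] _ _ _ _] := quaternion_structure (isT : 2 < 3) genG isoG.
have [sMX | /subsetPn[t Mt notXt]] := boolP (M \subset <[x]>).
  have /maxgroupP[_ /(_ <[x]>%G (maxgroupp maxX) sMX) <-] := maxM.
  exact: cycle_cyclic.
have Gt: t \in G := subsetP (proper_sub prM) t Mt.
have ot: #[t] = 4 by apply: o4; rewrite inE notXt.
suff <- : <[t]> = M by rewrite cycle_cyclic.
apply/eqP; rewrite eqEcard cycle_subG Mt -orderE ot.
rewrite -(leq_pmul2r (isT : 0 < 2)) -(p_maximal_index pG maxM).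
rewrite Lagrange ?proper_sub // (p_maximal_index pG maxM).
by rewrite (card_isog isoG) (@card_quaternion 3).
Qed.

End Comaximal.

Theorem theorem2p1 (gT : finGroupType) (G : {group gT}) (nilG : nilpotent G) :
  cluster_graph (comax_graph G) <->
  (exists p k : nat, [/\ prime p, cyclic G & #|G| = (p ^ k)%N]) \/
  (exists p : nat, prime p /\ G \isog setX (Zp p) (Zp p)) \/
  (G \isog 'Q_8) \/
  (exists p : nat, [/\ prime p, p.-group G, ~~ cyclic G &
     forall M : {group gT}, maximal M G -> cyclic M]) \/
  (exists p q : nat, [/\ prime p, prime q, p != q & G \isog Zp (p * q)%N]).
Proof.
split=> [clG | [[p [k [prp cycG oG]]] | [[p [prp isoG]] | [isoG | [|]]]]].
- case: (boolP (p_group G)) => [pG | notpG]; last first.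
    do 4!right; apply: cluster_not_pgroup => // p prp.
    by apply: contra notpG; apply: pgroup_p.
  have [p prp {}pG] := p_groupP pG.
  have [cycG | ncycG] := boolP (cyclic G).
    by left; exists p, (logn p #|G|); rewrite -card_pgroup.
  do 3!right; left; exists p; split=> // M maxM.
  exact: (cluster_maximal_cyclic pG).
- by apply: (@cyclic_cluster _ G p); rewrite // /pgroup oG pnatX pnat_id.
- apply: (card_psquare_cluster prp).
  by rewrite (card_isog isoG) cardsX card_Zp ?prime_gt0 ?mulnn.
- apply: (@maximal_cyclic_cluster _ G 2) => [|M].
    by rewrite /pgroup (card_isog isoG) (@card_quaternion 3).
  exact: quaternion8_maximal_cyclic isoG.
- by case=> p [_ pG _ cycM]; apply: maximal_cyclic_cluster pG cycM.
case=> p [q [prp prq _ isoG]]; apply: (card_pq_cluster nilG prp prq).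
by rewrite (card_isog isoG) card_Zp ?muln_gt0 ?prime_gt0.
Qed.
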